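(* Let $\gamma:[a,b]\to\mathbb K\setminus\{0\}$ be a path with companion $\mathfrak I^\gamma:[a,b]\to\mathbb S/\{\pm\mathrm{Id}\}$. Then there exist a path $\mathcal I^\gamma:[a,b]\to\mathbb S$ with $[\mathcal I^\gamma(t)]=\mathfrak I^\gamma(t)$ for all $t\in[a,b]$, and a path $\arg^\gamma:[a,b]\to\mathbb R$, such that, after setting $\operatorname{Arg}^\gamma=\mathcal I^\gamma\arg^\gamma:[a,b]\to\operatorname{Im}(\mathbb K)$, the path $$\Gamma(t)=(\gamma(t),\operatorname{Arg}^\gamma(t))$$ is a lift of $\gamma$ to $\mathcal E_{\mathbb K}^+$ with $\arg^\gamma(a)\in[0,\pi]$. If for every $k\in\mathbb Z$ we set $\arg^\gamma_{2k}:=\arg^\gamma+2k\pi$ and $\operatorname{Arg}^\gamma_{2k}:=\mathcal I^\gamma\arg^\gamma_{2k}$, then the path $$\Gamma_k(t)=(\gamma(t),\operatorname{Arg}^\gamma_{2k}(t))$$ is a lift of $\gamma$ to $\mathcal E_{\mathbb K}^+$ with $\arg^\gamma_{2k}(a)\in[2k\pi,(2k+1)\pi]$.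
   Context: $\mathbb K$ denotes either the algebra of quaternions or the algebra of octonions, $\operatorname{Im}(\mathbb K)$ its space of purely imaginary elements, $\mathbb S=\{I\in\mathbb K: I^2=-1\}$ and $\mathbb C_I=\mathbb R+\mathbb RI$ for $I\in\mathbb S$. A path is a continuous map from a compact interval. $\exp(q)=\sum_{k\ge 0}q^k/k!$. The logarithm manifold is $\mathcal E_{\mathbb K}^+=\{(r\exp p,p): r>0,\ p\in\operatorname{Im}(\mathbb K)\}\subset\mathbb K\times\operatorname{Im}(\mathbb K)$, with $\mathrm{pr}_1(q,p)=q$; a lift of $\gamma$ to it is a path $\Gamma$ in $\mathcal E_{\mathbb K}^+$ with $\mathrm{pr}_1\circ\Gamma=\gamma$. $\mathbb S/\{\pm\mathrm{Id}\}$ is the real projective space obtained by identifying antipodal points of $\mathbb S$; $[J]$ is the class of $J\in\mathbb S$, and $\mathbb C_{[J]}:=\mathbb C_J=\mathbb C_{-J}$. A companion of the path $\gamma$ is a path $\mathfrak I^\gamma:[a,b]\to\mathbb S/\{\pm\mathrm{Id}\}$ such that $\gamma(t)\in\mathbb C_{\mathfrak I^\gamma(t)}$ for every $t\in[a,b]$. *)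

(* Defs.v *)
From HB Require Import structures.
From mathcomp Require Export all_boot all_order all_algebra.
From mathcomp Require Export all_classical all_reals all_analysis.
Export Order.TTheory GRing.Theory Num.Theory.
Export numFieldNormedType.Exports.

Set Implicit Arguments.
Unset Strict Implicit.
Unset Printing Implicit Defensive.

Local Open Scope classical_set_scope.
Local Open Scope ring_scope.

(* Iterated Cayley-Dickson doubling of the reals: cd R 1, cd R 2 and cd R 3 are
   the complex numbers, the quaternions and the octonions.  The norm is the sup
   norm of the product, hence the topology is the Euclidean one. *)
Fixpoint cd (R : realType) (n : nat) : normedModType R :=
  if n is m.+1 then (cd R m * cd R m)%type else R^o.

Fixpoint cd_conj (R : realType) (n : nat) : cd R n -> cd R n :=
  if n is m.+1 return cd R n -> cd R n
  then fun x => (cd_conj x.1, - x.2) else fun x => x.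

Fixpoint cd_mul (R : realType) (n : nat) : cd R n -> cd R n -> cd R n :=
  if n is m.+1 return cd R n -> cd R n -> cd R n
  then fun x y => (cd_mul x.1 y.1 - cd_mul (cd_conj y.2) x.2,
                   cd_mul y.2 x.1 + cd_mul x.2 (cd_conj y.1))
  else fun x y => (x : R) * (y : R).

Fixpoint cd_one (R : realType) (n : nat) : cd R n :=
  if n is m.+1 return cd R n then (cd_one R m, 0) else (1 : R).

Fixpoint cd_re (R : realType) (n : nat) : cd R n -> R :=
  if n is m.+1 return cd R n -> R then fun x => cd_re x.1 else fun x => x.

Variant hypercomplex := Quaternions | Octonions.

Definition cd_level (K : hypercomplex) : nat :=
  match K with Quaternions => 2 | Octonions => 3 end.

Section Hypercomplex.
Variables (R : realType) (K : hypercomplex).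

Definition hc : normedModType R := cd R (cd_level K).

Definition hmul (p q : hc) : hc := cd_mul p q.

Definition hone : hc := cd_one R (cd_level K).

Definition hIm : set hc := [set p | cd_re p = 0].

(* Both algebras are power-associative, so the bracketing is irrelevant. *)
Definition hpow (q : hc) (k : nat) : hc := iter k (hmul q) hone.

Definition hexp (q : hc) : hc :=
  limn (series (fun k => (k`!%:R : R)^-1 *: hpow q k)).

Definition unit_sphere : set hc := [set I | hmul I I = - hone].

(* The type of elements of S, with the topology induced by hc. *)
Definition sphere : topologicalType := set_type unit_sphere.

Definition slice (I : sphere) : set hc :=
  [set q | exists x y : R, q = x *: hone + y *: set_val I].

Definition antipodal (I J : sphere) : bool :=
  (set_val I == set_val J :> hc) || (set_val I == - set_val J :> hc).

Lemma antipodal_equiv : equiv_class_of antipodal.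
Proof.
split=> [I|I J|J I L]; rewrite /antipodal; first by rewrite eqxx.
  by rewrite eq_sym -eqr_oppLR (eq_sym (- _)).
move=> /orP[]/eqP-> /orP[]/eqP->; by rewrite ?opprK eqxx ?orbT.
Qed.

Canonical antipodal_equiv_rel := EquivRelPack antipodal_equiv.

(* The real projective space S/{+-Id}, with the quotient topology. *)
Definition proj_sphere : topologicalType :=
  quotient_topology {eq_quot antipodal_equiv_rel}%qT.

Definition proj_class (J : sphere) : proj_sphere :=
  (\pi_({eq_quot antipodal_equiv_rel}) J)%qT.

(* C_[J]; independent of the representative by slice_class_pi below. *)
Definition slice_class (x : proj_sphere) : set hc :=
  slice (repr (x : {eq_quot antipodal_equiv_rel}%qT)).

Lemma proj_classP (I J : sphere) :
  proj_class I = proj_class J <->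
  (set_val I = set_val J :> hc \/ set_val I = - set_val J :> hc).
Proof.
rewrite /proj_class; split=> [/eqmodP/orP[]/eqP|]; [by left|by right|].
by move=> IJ; apply/eqmodP/orP; case: IJ => ->; [left|right].
Qed.

Lemma slice_class_pi (J : sphere) : slice_class (proj_class J) = slice J.
Proof.
rewrite /slice_class; set I := repr _.
have /proj_classP[IJ|IJ] : proj_class I = proj_class J by exact: reprK.
  by rewrite /slice IJ.
rewrite /slice IJ; apply/seteqP; split=> q [x [y ->]]; exists x, (- y);
  by rewrite ?scalerN scaleNr ?opprK.
Qed.

(* The logarithm manifold E_K^+, as a subset of hc * hc. *)
Definition log_manifold : set (hc * hc) :=
  [set z | hIm z.2 /\ exists2 r : R, 0 < r & z.1 = r *: hexp z.2].

(* Functions on [a, b] are represented by functions on R, of which only the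
   restriction to [a, b] is used. *)
Definition is_path (T : topologicalType) (a b : R) (f : R -> T) : Prop :=
  {within `[a, b], continuous f}.

Definition is_lift (a b : R) (gamma : R -> hc) (Gamma : R -> hc * hc) : Prop :=
  [/\ is_path a b Gamma,
      forall t, t \in `[a, b] -> log_manifold (Gamma t) &
      forall t, t \in `[a, b] -> (Gamma t).1 = gamma t].

Definition is_companion (a b : R) (gamma : R -> hc) (Ig : R -> proj_sphere) :
  Prop :=
  is_path a b Ig /\ forall t, t \in `[a, b] -> slice_class (Ig t) (gamma t).

End Hypercomplex.

(* Main.v *)
Require Import Defs.
From mathcomp Require Import ring lra.
Local Open Scope classical_set_scope.
Local Open Scope ring_scope.

(* Over a compact interval one lifts the sphere-valued and the angular
   coordinate simultaneously.  Locally the companion has a continuous choice of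
   unit vector J (the antipodal quotient is a covering), and the planar path of
   coordinates of gamma with respect to (1, J) has a continuous argument.  Such
   a local lift can be started at any admissible pair (J0, th0) by flipping
   (J, th) to (-J, -th) if necessary and shifting th by a multiple of 2 pi, so
   the local lifts chain together along [a, b].  At t = a the sign of J is
   chosen to make the imaginary coordinate nonnegative, which puts the angle in
   [0, pi].  Finally exp (th J) = cos th + J sin th turns the polar form into a
   point of the logarithm manifold. *)

Set Implicit Arguments.
Unset Strict Implicit.
Unset Printing Implicit Defensive.

(** * Bilinear algebra of the Cayley-Dickson doublings *)

Section CayleyDickson.
Context {R : realType}.

Lemma cd_eqP n (x y : cd R n.+1) : x.1 = y.1 -> x.2 = y.2 -> x = y.
Proof. by case: x y => [? ?] [? ?] /= -> ->. Qed.

Lemma cd_fstD n (x y : cd R n.+1) : (x + y).1 = x.1 + y.1. Proof. by []. Qed.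
Lemma cd_sndD n (x y : cd R n.+1) : (x + y).2 = x.2 + y.2. Proof. by []. Qed.
Lemma cd_fstN n (x : cd R n.+1) : (- x).1 = - x.1. Proof. by []. Qed.
Lemma cd_sndN n (x : cd R n.+1) : (- x).2 = - x.2. Proof. by []. Qed.
Lemma cd_fstZ n k (x : cd R n.+1) : (k *: x).1 = k *: x.1. Proof. by []. Qed.
Lemma cd_sndZ n k (x : cd R n.+1) : (k *: x).2 = k *: x.2. Proof. by []. Qed.
Lemma cd_mul_fst n (x y : cd R n.+1) :
  (cd_mul x y).1 = cd_mul x.1 y.1 - cd_mul (cd_conj y.2) x.2.
Proof. by []. Qed.
Lemma cd_mul_snd n (x y : cd R n.+1) :
  (cd_mul x y).2 = cd_mul y.2 x.1 + cd_mul x.2 (cd_conj y.1).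
Proof. by []. Qed.
Lemma cd_conj_fst n (x : cd R n.+1) : (cd_conj x).1 = cd_conj x.1.
Proof. by []. Qed.
Lemma cd_conj_snd n (x : cd R n.+1) : (cd_conj x).2 = - x.2.
Proof. by []. Qed.

(* Rewriting with these, unlike simplification, leaves the recursive operations
   folded. *)
Definition cd_projE :=
  (cd_fstD, cd_sndD, cd_fstN, cd_sndN, cd_fstZ, cd_sndZ,
   cd_mul_fst, cd_mul_snd, cd_conj_fst, cd_conj_snd).

(** The two sides go through one induction because doubling swaps factors: [x.2] stands on the right
    in the product [cd_mul (cd_conj y.2) x.2], so linearity on one side at level [n.+1] uses both
    sides at level [n]. *)
Lemma cd_mul_linear n (k : R) :
  (forall x y z : cd R n,
     cd_mul (k *: x + y) z = k *: cd_mul x z + cd_mul y z) /\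
  (forall x y z : cd R n,
     cd_mul z (k *: x + y) = k *: cd_mul z x + cd_mul z y).
Proof.
have conj_linear m (x y : cd R m) :
    cd_conj (k *: x + y) = k *: cd_conj x + cd_conj y.
  elim: m x y => [//|m IH] x y.
  by apply: cd_eqP; rewrite !cd_projE ?IH// opprD scalerN.
elim: n => [|n [IHl IHr]].
  by split=> x y z /=; [rewrite mulrDl -mulrA|rewrite mulrDr mulrCA].
by split=> x y z; apply: cd_eqP;
  rewrite !cd_projE ?conj_linear ?IHl ?IHr scalerDr ?scalerN ?opprD;
  rewrite addrACA.
Qed.

Lemma cd_mulDr n (x y z : cd R n) :
  cd_mul z (x + y) = cd_mul z x + cd_mul z y.
Proof. by have [_ /(_ x y z)] := cd_mul_linear n 1; rewrite !scale1r. Qed.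

Lemma cd_mul0l n (x : cd R n) : cd_mul 0 x = 0.
Proof.
by have [/(_ 0 0 x)+ _] := cd_mul_linear n (-1);
  rewrite !scaleN1r oppr0 addr0 addNr.
Qed.

Lemma cd_mul0r n (x : cd R n) : cd_mul x 0 = 0.
Proof.
by have [_ /(_ 0 0 x)] := cd_mul_linear n (-1);
  rewrite !scaleN1r oppr0 addr0 addNr.
Qed.

Lemma cd_mulZl n (k : R) (x y : cd R n) : cd_mul (k *: x) y = k *: cd_mul x y.
Proof.
by have [/(_ x 0 y)+ _] := cd_mul_linear n k; rewrite cd_mul0l !addr0.
Qed.

Lemma cd_mulZr n (k : R) (x y : cd R n) : cd_mul y (k *: x) = k *: cd_mul y x.
Proof.
by have [_ /(_ x 0 y)] := cd_mul_linear n k; rewrite cd_mul0r !addr0.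
Qed.

Lemma cd_mul1r n (x : cd R n) : cd_mul x (cd_one R n) = x.
Proof.
have conj0 m : cd_conj (0 : cd R m) = 0.
  by elim: m => //= m ->; rewrite oppr0.
have conj1 m : cd_conj (cd_one R m) = cd_one R m.
  by elim: m => //= m ->; rewrite oppr0.
elim: n x => [x|n IH x]; first by rewrite /= mulr1.
by apply: cd_eqP; rewrite !cd_projE/= ?conj0 ?conj1 !cd_mul0l !IH ?subr0 ?add0r.
Qed.

(** The norm of [cd R n] is the sup norm, so the Euclidean inner product is introduced separately;
    it serves to read off coordinates along [1] and a unit [J]. *)
Fixpoint cd_dot n : cd R n -> cd R n -> R :=
  if n is m.+1 return cd R n -> cd R n -> R
  then fun x y => cd_dot x.1 y.1 + cd_dot x.2 y.2 else fun x y => x * y.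

Lemma cd_dotS n (x y : cd R n.+1) :
  cd_dot x y = cd_dot x.1 y.1 + cd_dot x.2 y.2.
Proof. by []. Qed.

Lemma cd_dotC n (x y : cd R n) : cd_dot x y = cd_dot y x.
Proof.
elim: n x y => [x y|n IH x y]; first by rewrite /= mulrC.
by rewrite !cd_dotS IH [X in _ + X]IH.
Qed.

Lemma cd_dotDl n (x y z : cd R n) :
  cd_dot (x + y) z = cd_dot x z + cd_dot y z.
Proof.
elim: n x y z => [x y z|n IH x y z]; first exact: mulrDl.
by rewrite !cd_dotS !cd_projE !IH addrACA.
Qed.

Lemma cd_dotZl n (k : R) (x y : cd R n) :
  cd_dot (k *: x) y = k * cd_dot x y.
Proof.
elim: n x y => [x y|n IH x y]; first by rewrite /= mulrA.
by rewrite !cd_dotS !cd_projE !IH mulrDr.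
Qed.

Lemma cd_dotDr n (x y z : cd R n) :
  cd_dot z (x + y) = cd_dot z x + cd_dot z y.
Proof. by rewrite ![cd_dot z _]cd_dotC cd_dotDl. Qed.

Lemma cd_dotZr n (k : R) (x y : cd R n) :
  cd_dot y (k *: x) = k * cd_dot y x.
Proof. by rewrite ![cd_dot y _]cd_dotC cd_dotZl. Qed.

Lemma cd_dotNl n (x y : cd R n) : cd_dot (- x) y = - cd_dot x y.
Proof. by rewrite -scaleN1r cd_dotZl mulN1r. Qed.

Lemma cd_dot1l n (x : cd R n) : cd_dot (cd_one R n) x = cd_re x.
Proof.
have dot0 m (y : cd R m) : cd_dot 0 y = 0.
  by rewrite -(scale0r 0) cd_dotZl mul0r.
elim: n x => [x|n IH x]; first by rewrite /= mul1r.
by rewrite cd_dotS/= IH dot0 addr0.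
Qed.

Lemma cd_re1 n : cd_re (cd_one R n) = 1.
Proof. by elim: n. Qed.

(** The quadratic identity of a Cayley-Dickson algebra, valid without associativity. In the
    induction the first component uses that conjugate times [y] is the squared length of [y], and
    the second that [y] plus its conjugate is twice the real part. *)
Lemma cd_sqr n (x : cd R n) :
  cd_mul x x = (2 * cd_re x) *: x - cd_dot x x *: cd_one R n.
Proof.
have addr_conj m (y : cd R m) : y + cd_conj y = (2 * cd_re y) *: cd_one R m.
  elim: m y => [y|m IH y] /=; first by rewrite [RHS]mulr1 mulr_natl mulr2n.
  by apply: cd_eqP; rewrite !cd_projE/= ?IH// subrr scaler0.
have conj_mul m (y : cd R m) : cd_mul (cd_conj y) y = cd_dot y y *: cd_one R m.
  elim: m y => [y|m IH y] /=; first by rewrite [RHS]mulr1.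
  apply: cd_eqP; rewrite !cd_projE/=.
    by rewrite -[- y.2]scaleN1r cd_mulZr scaleN1r opprK !IH scalerDl.
  by rewrite -[- y.2]scaleN1r cd_mulZl scaleN1r subrr scaler0.
elim: n x => [x|n IH x].
  have -> : (2 * cd_re x) *: x - cd_dot x x *: cd_one R 0 =
            (2 * (x : R)) * x - x * x * 1 :> R by [].
  by rewrite /=; ring.
apply: cd_eqP; rewrite !cd_projE/=.
  by rewrite IH conj_mul scalerDl opprD addrA.
by rewrite -cd_mulDr addr_conj cd_mulZr cd_mul1r scaler0 subr0.
Qed.

Lemma cd_dot_cvg n (T : Type) (F : set_system T) {FF : Filter F}
    (f g : T -> cd R n) x y :
  f @ F --> x -> g @ F --> y ->
  cd_dot (f t) (g t) @[t --> F] --> cd_dot x y.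
Proof.
elim: n f g x y => [|n IH] f g x y fx gy /=; first exact: cvgM.
apply: (@cvgD _ R^o); apply: IH; apply: cvg_comp; try exact: fx; try exact: gy.
- exact: cvg_fst.
- exact: cvg_fst.
- exact: cvg_snd.
- exact: cvg_snd.
Qed.

End CayleyDickson.

(** * Imaginary units and the exponential on a slice *)

Section Sphere.
Context {R : realType} {K : hypercomplex}.
Implicit Types (I J : sphere R K) (p q : hc R K).

Lemma sphereP I : hmul (set_val I) (set_val I) = - hone R K.
Proof. exact: (set_valP I). Qed.

(** If the real part were nonzero, [cd_sqr] could be solved for [I], making it a real multiple [c]
    of [1]; but then its square would be [c ^+ 2], which is not [-1]. *)
Lemma sphere_re I : cd_re (set_val I : hc R K) = 0.
Proof.
set v : hc R K := set_val I; apply/eqP/contraT => re0.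
have := sphereP I; rewrite /hmul cd_sqr -/v => vv.
have [c vc] : exists c : R, v = c *: hone R K.
  exists ((2 * cd_re v)^-1 * (cd_dot v v - 1)).
  rewrite -scalerA scalerBl scale1r -vv subrKC scalerA mulVf ?scale1r//.
  by rewrite mulf_neq0.
have := sphereP I.
rewrite -/v vc /hmul /hone cd_mulZl cd_mulZr cd_mul1r scalerA.
move=> /(congr1 (@cd_re R _)).
rewrite -!cd_dot1l -scaleN1r !cd_dotZr cd_dot1l cd_re1.
by move=> h; have := sqr_ge0 c; nra.
Qed.

Lemma sphere_dot I : cd_dot (set_val I : hc R K) (set_val I) = 1.
Proof.
have := sphereP I; rewrite /hmul cd_sqr sphere_re mulr0 scale0r sub0r.
move=> /oppr_inj /(congr1 (@cd_re R _)).
by rewrite -!cd_dot1l cd_dotZr cd_dot1l cd_re1 mulr1.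
Qed.

Lemma sphere_oppP I : unit_sphere (- set_val I : hc R K).
Proof.
have vv : cd_mul (set_val I : hc R K) (set_val I) = - hone R K := sphereP I.
rewrite /unit_sphere /mkset /hmul -[- set_val I]scaleN1r.
by rewrite cd_mulZl cd_mulZr scalerA mulrNN mulr1 scale1r.
Qed.

Definition sphere_opp I : sphere R K := SigSub (mem_set (sphere_oppP I)).

(** Powers of [I] cycle since its square is [-1]. The coefficients are written with parity factors
    and halved exponents to match the numerators of [cos_coeff] and [sin_coeff]. *)
Lemma hpow_sphere I (t : R) k :
  hpow (t *: set_val I) k =
    ((~~ odd k)%:R * (-1) ^+ k./2 * t ^+ k) *: hone R K +
    ((odd k)%:R * (-1) ^+ k.-1./2 * t ^+ k) *: set_val I.
Proof.
elim: k => [|k]; first by rewrite /hpow/= !expr0 !mulr1 scale1r scale0r addr0.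
have step (c d : R) : hmul (t *: set_val I) (c *: hone R K + d *: set_val I) =
    (- (t * d)) *: hone R K + (t * c) *: set_val I.
  have vv : cd_mul (set_val I : hc R K) (set_val I) = - hone R K := sphereP I.
  rewrite /hmul cd_mulDr !cd_mulZr !cd_mulZl cd_mul1r vv.
  by rewrite !scalerA scalerN scaleNr addrC [t * c]mulrC [t * d]mulrC.
have -> : hpow (t *: set_val I) k.+1 =
  hmul (t *: set_val I) (hpow (t *: set_val I) k) by [].
move=> ->; rewrite step; congr (_ *: _ + _ *: _).
  (* At [k = 0] the truncated predecessor is harmless, as the parity factor vanishes. *)
  case: k => [|k] /=; first by rewrite !mul0r mulr0 oppr0.
  by rewrite negbK !exprS; case: (odd k) => /=; ring.
by rewrite exprS; case: k => [|k] /=; ring.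
Qed.

(** Euler's formula: each partial sum splits into a cosine partial sum along [1] and a sine partial
    sum along [I]. *)
Lemma hexp_sphere I (t : R) :
  hexp (t *: set_val I) = cos t *: hone R K + sin t *: set_val I.
Proof.
apply: cvg_lim; first exact: norm_hausdorff.
rewrite (_ : series _ = fun n => series (cos_coeff t) n *: hone R K +
                                 series (sin_coeff t) n *: set_val I).
  apply: cvgD; apply: cvgZr_tmp; rewrite ?cos.unlock ?sin.unlock.
    exact: is_cvg_series_cos_coeff.
  exact: is_cvg_series_sin_coeff.
apply/funext => n; rewrite /series/= !scaler_suml -big_split/=.
apply: eq_bigr => k _; rewrite hpow_sphere scalerDr !scalerA.
by congr (_ *: _ + _ *: _); rewrite [LHS]mulrC.
Qed.

End Sphere.

(** * Induction along a segment and planar polar angles *)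

Section RealLemmas.
Context {R : realType}.

(** Supremum argument: the local property at the supremum of the points reachable from [a] would
    carry the chain beyond it, unless [b] is reached first. *)
Lemma segment_chain (P : R -> R -> Prop) (a b : R) : a <= b ->
  (forall c d e, c <= d -> d <= e -> P c d -> P d e -> P c e) ->
  (forall t, exists2 e : R, 0 < e &
    forall c d, c <= d -> ball t e c -> ball t e d -> P c d) ->
  P a b.
Proof.
move=> ab trP locP; set A := [set s | a <= s <= b /\ P a s].
have Aa : A a.
  split; first by rewrite lexx.
  by have [e e0] := locP a; apply=> //; exact: ballxx.
have ubA : ubound A b by move=> s [/andP[]].
have supA : has_sup A by split; [exists a|exists b].
have [e e0 locs] := locP (sup A).
have e20 : 0 < e / 2 by rewrite divr_gt0.
have [s As sS] := sup_adherent e20 supA.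
have sleS : s <= sup A := sup_upper_bound supA As.
(* A reachable [s] within [e / 2] below the supremum and this endpoint lie in the same ball; the
   minimum keeps the endpoint from passing [b]. *)
have Pad : P a (Num.min b (sup A + e / 2)).
  have [/andP[as_ sb] Pas] := As.
  have sd : s <= Num.min b (sup A + e / 2) by rewrite le_min sb; lra.
  apply: (trP _ s) => //; apply: locs => //.
    by rewrite /ball/= ltr_norml; lra.
  rewrite /ball/= ltr_norml; move: sd; case: (leP b) => ? ?; lra.
have [bd|db] := leP b (sup A + e / 2); first by move: Pad; rewrite min_l.
have Ad : A (sup A + e / 2).
  move: Pad; rewrite min_r ?(ltW db)// => Pad; split=> //.
  have : a <= sup A by apply: sup_upper_bound.
  by move=> ?; apply/andP; split; lra.
by have := sup_upper_bound supA Ad; lra.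
Qed.

(** The angle is [acos (x / r)], which lies between [0] and [pi]; its sine is a nonnegative square
    root, hence equals [y / r] because [y] is nonnegative. *)
Lemma polar_coord_ge0 (r x y : R) : 0 < r -> r ^+ 2 = x ^+ 2 + y ^+ 2 ->
  0 <= y -> exists2 th, 0 <= th <= pi & x = r * cos th /\ y = r * sin th.
Proof.
move=> r0 r2 y0.
have xr : -1 <= x / r <= 1.
  have xr2 : x ^+ 2 <= r ^+ 2 by rewrite r2 lerDl sqr_ge0.
  by rewrite ler_pdivlMr// ler_pdivrMr//; apply/andP; split; nra.
exists (acos (x / r)); first by rewrite acos_ge0// acos_lepi.
have rN0 : r != 0 by rewrite gt_eqF.
have cE : cos (acos (x / r)) = x / r by apply: acosK; rewrite in_itv.
rewrite cE; split; first by rewrite mulrC divfK.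
rewrite sin_acos//.
have -> : 1 - (x / r) ^+ 2 = (y / r) ^+ 2.
  have y2 : y ^+ 2 = r ^+ 2 - x ^+ 2 by rewrite r2 addrC addKr.
  by rewrite !expr_div_n y2; field.
rewrite sqrtr_sqr ger0_norm; first by rewrite mulrC divfK.
by rewrite divr_ge0// ltW.
Qed.

Lemma polar_coord (r x y : R) : 0 < r -> r ^+ 2 = x ^+ 2 + y ^+ 2 ->
  exists th, x = r * cos th /\ y = r * sin th.
Proof.
move=> r0 r2; have [y0|y0] := leP 0 y.
  by have [th _ ?] := polar_coord_ge0 r0 r2 y0; exists th.
have [||th _ [xE yE]] := @polar_coord_ge0 r x (- y) r0.
- by rewrite sqrrN.
- by rewrite oppr_ge0 ltW.
by exists (- th); rewrite cosN sinN mulrN -xE -yE opprK.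
Qed.

Lemma continuous_polar_angle (x0 y0 : R) : 0 < x0 ^+ 2 + y0 ^+ 2 ->
  exists A : R * R -> R, \forall z \near (x0, y0), {for z, continuous A} /\
    exists2 r, 0 < r & z.1 = r * cos (A z) /\ z.2 = r * sin (A z).
Proof.
move=> n0.
have [s s0 s2] : exists2 s : R, 0 < s & s ^+ 2 = x0 ^+ 2 + y0 ^+ 2.
  exists (Num.sqrt (x0 ^+ 2 + y0 ^+ 2)); first by rewrite sqrtr_gt0.
  by rewrite sqr_sqrtr// ltW.
have [al [x0E y0E]] := polar_coord s0 s2.
(* [(u, v)] is [z] rotated by [- al]. The base point lands on the positive real axis, and on the
   half plane [0 < u] the angle is [atan (v / u)]. *)
pose u (z : R * R) : R := z.1 * cos al + z.2 * sin al.
pose v (z : R * R) : R := z.2 * cos al - z.1 * sin al.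
have cu : continuous u.
  by move=> z; apply: cvgD; (apply: cvgM; last exact: cvg_cst);
    [exact: cvg_fst|exact: cvg_snd].
have cv : continuous v.
  by move=> z; apply: cvgB; (apply: cvgM; last exact: cvg_cst);
    [exact: cvg_snd|exact: cvg_fst].
have u0 : 0 < u (x0, y0).
  by rewrite /u/= x0E y0E -!mulrA -mulrDr -!expr2 cos2Dsin2 mulr1.
exists (fun z => al + atan (v z / u z)).
have : \forall z \near (x0, y0), 0 < u z.
  by apply: (cu (x0, y0) [set w | 0 < w]); exact: lt_nbhsr.
apply: filterS => z uz.
have uN0 : u z != 0 by rewrite gt_eqF.
set w : R := v z / u z.
have sw : (0 : R) < Num.sqrt (1 + w ^+ 2).
  by rewrite sqrtr_gt0 ltr_pwDl// sqr_ge0.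
(* Since [u z] is positive, this is the modulus of [z]. *)
pose r : R := u z * Num.sqrt (1 + w ^+ 2).
have rE : r * cos (atan w) = u z.
  by rewrite cos_atan mulfK// gt_eqF.
have rsE : r * sin (atan w) = v z.
  have cN0 : cos (atan w) != 0 by rewrite cos_atan invr_eq0 gt_eqF.
  have := atanK w; rewrite /tan => /(congr1 ( *%R^~ (cos (atan w)))).
  by rewrite divfK// => ->; rewrite mulrCA rE /w divfK.
split.
  apply: cvgD; first exact: cvg_cst.
  apply: (@continuous_comp _ _ _ (fun z => v z / u z) atan).
    by apply: cvgM; [exact: cv|apply: cvgV => //; exact: cu].
  exact: continuous_atan.
have cs := cos2Dsin2 al.
exists r; first by rewrite mulr_gt0.
split; first rewrite cosD mulrBr mulrCA rE mulrCA rsE /u /v.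
  rewrite -[LHS]mulr1 -cs; ring.
rewrite sinD mulrDr mulrCA rE mulrCA rsE /u /v -[LHS]mulr1 -cs; ring.
Qed.

End RealLemmas.

(** * The projective sphere, slices and polar forms *)

Section Lifting.
Context {R : realType} {K : hypercomplex}.
Implicit Types (I J : sphere R K) (p q : hc R K).

Lemma sphere_continuous_at (T : topologicalType) (f : T -> sphere R K) x :
  {for x, continuous (fun t => set_val (f t) : hc R K)} ->
  {for x, continuous f}.
Proof.
move=> fx U [_ /= [[W oW <-] Wfx]] /filterS; apply.
by apply: fx; exact: open_nbhs_nbhs.
Qed.

Lemma set_val_continuous : continuous (set_val : sphere R K -> hc R K).
Proof.
exact: (@initial_continuous (set_type (@unit_sphere R K)) (hc R K) set_val).
Qed.

Lemma sphere_val_inj I J : set_val I = set_val J :> hc R K -> I = J.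
Proof. by move=> /val_inj. Qed.

Lemma sphere_oppK : involutive (@sphere_opp R K).
Proof. by move=> J; apply: sphere_val_inj; exact: opprK. Qed.

Lemma sphere_opp_continuous : continuous (@sphere_opp R K).
Proof.
move=> J; apply: sphere_continuous_at.
apply: (@continuous_comp _ _ _ (set_val : sphere R K -> hc R K) -%R).
  exact: set_val_continuous.
exact: oppr_continuous.
Qed.

Lemma proj_class_opp J : proj_class (sphere_opp J) = proj_class J.
Proof. by apply/proj_classP; right. Qed.

Lemma proj_class_eq I J :
  proj_class I = proj_class J -> I = J \/ I = sphere_opp J.
Proof. by move=> /proj_classP[] ?; [left|right]; exact: sphere_val_inj. Qed.

(** [1] and [J] are orthonormal for [cd_dot], so the coordinates are inner products. *)
Lemma slice_decomp J q : slice J q ->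
  q = cd_re q *: hone R K + cd_dot q (set_val J) *: set_val J.
Proof.
move=> [x [y ->]].
rewrite -[cd_re _]cd_dot1l cd_dotDl cd_dotDr !cd_dotZl !cd_dotZr !cd_dot1l.
by rewrite cd_re1 sphere_re sphere_dot !mulr1 !mulr0 addr0 add0r.
Qed.

(* On the complement of the hyperplane orthogonal to [J0], the lines of the
   projective space have a continuous choice of unit vector: [J |-> <J,J0> J]
   and [J |-> |<J,J0>|] are even, hence descend to the quotient, and their
   ratio is the representative on the side of [J0]. *)
Lemma proj_section J0 : exists s : proj_sphere R K -> sphere R K,
  (forall x, proj_class (s x) = x) /\
  \forall x \near proj_class J0, {for x, continuous s}.
Proof.
pose D J : R := cd_dot (set_val J : hc R K) (set_val J0).
have cD : continuous D.
  move=> J; exact: (cd_dot_cvg (@set_val_continuous J) (cvg_cst _)).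
pose rp (x : proj_sphere R K) : sphere R K := repr (x : {eq_quot _}%qT).
have rpK x : proj_class (rp x) = x by exact: reprK.
pose s x := if 0 < D (rp x) then rp x else sphere_opp (rp x).
have sE x : proj_class (s x) = x.
  by rewrite /s; case: ifP => _; rewrite ?proj_class_opp rpK.
have DN J : D (sphere_opp J) = - D J by exact: cd_dotNl.
have cG : continuous (fun x => `|D (rp x)| : R^o).
  apply: (@repr_comp_continuous _ _ R^o (fun J => `|D J|)).
    by move=> J; exact: (@cvg_norm _ R^o _ _ _ _ _ (cD J)).
  move=> I J /eqP /proj_class_eq[->//|->].
  by rewrite DN normrN.
have cF : continuous (fun x => D (rp x) *: (set_val (rp x) : hc R K)).
  apply: (@repr_comp_continuous _ _ (hc R K) (fun J => D J *: set_val J)).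
    by move=> J; exact: (cvgZ (cD J) (@set_val_continuous J)).
  move=> I J /eqP /proj_class_eq[->//|->].
  by rewrite DN scalerN scaleNr opprK.
exists s; split=> //.
pose V : set (proj_sphere R K) := [set x | 0 < `|D (rp x)|].
have oV : open V.
  by move/continuousP: cG => /(_ [set y : R^o | 0 < y]); apply; exact: open_gt.
have VJ0 : V (proj_class J0).
  rewrite /V/= normr_gt0.
  have /proj_class_eq[->|->] := rpK (proj_class J0).
    by rewrite /D sphere_dot oner_eq0.
  by rewrite DN /D sphere_dot oppr_eq0 oner_eq0.
have sV x : V x ->
    set_val (s x) = `|D (rp x)|^-1 *: (D (rp x) *: set_val (rp x)) :> hc R K.
  rewrite /V /s/= normr_gt0 scalerA => D0; case: ltP => [D_gt0|D_le0].
    by rewrite gtr0_norm// mulVf// scale1r.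
  by rewrite ler0_norm// invrN mulNr mulVf// scaleN1r.
have : nbhs (proj_class J0) V by exact: open_nbhs_nbhs.
apply: filterS => x Vx; apply: sphere_continuous_at.
rewrite /prop_for /continuous_at sV//.
have nV : \forall y \near x, V y by exact: open_nbhs_nbhs.
have sV_near : {near x,
    (fun y => `|D (rp y)|^-1 *: (D (rp y) *: set_val (rp y))) =1
    (fun y => set_val (s y) : hc R K)}.
  by apply: filterS nV => y /sV ->.
apply: (cvg_trans (near_eq_cvg sV_near)).
have DN0 : `|D (rp x)| != 0 by rewrite gt_eqF.
exact: (cvgZ (cvgV DN0 (cG x)) (cF x)).
Qed.

Definition polar_form q J (th : R) :=
  exists2 r : R, 0 < r & q = r *: (cos th *: hone R K + sin th *: set_val J).

Lemma polar_form_opp q J th :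
  polar_form q J th -> polar_form q (sphere_opp J) (- th).
Proof.
by move=> [r r0 ->]; exists r => //; rewrite cosN sinN scaleNr scalerN opprK.
Qed.

Lemma polar_form_coord q J th : polar_form q J th ->
  exists2 r : R, 0 < r &
    cd_re q = r * cos th /\ cd_dot q (set_val J) = r * sin th.
Proof.
move=> [r r0 ->]; exists r => //.
rewrite -[cd_re _]cd_dot1l cd_dotZr cd_dotDr cd_dotZl cd_dotDl !cd_dotZl
  !cd_dotZr !cd_dot1l.
by rewrite cd_re1 sphere_re sphere_dot !mulr1 !mulr0 addr0 add0r.
Qed.

(** Both moduli have the same square, the sum of the squared coordinates of [q], so they agree and
    cancel. *)
Lemma polar_form_cos_sin q J th th' : polar_form q J th ->
  polar_form q J th' -> cos th = cos th' /\ sin th = sin th'.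
Proof.
move=> /polar_form_coord[r r0 [xE yE]] /polar_form_coord[r' r'0 [cE sE]].
rewrite {}xE in cE; rewrite {}yE in sE.
have rr' : r = r'.
  apply/eqP; rewrite -(@eqrXn2 _ 2)// ?ltW//.
  rewrite -[r ^+ 2]mulr1 -[r' ^+ 2]mulr1 -{1}(cos2Dsin2 th) -(cos2Dsin2 th').
  by rewrite !mulrDr -!exprMn cE sE.
have r'N0 : r' != 0 by rewrite gt_eqF.
by move: cE sE; rewrite rr' => /(mulfI r'N0) ? /(mulfI r'N0).
Qed.

Lemma slice_norm_gt0 J q : slice J q -> q != 0 ->
  0 < cd_re q ^+ 2 + cd_dot q (set_val J) ^+ 2.
Proof.
move=> /slice_decomp qE q0; rewrite lt0r addr_ge0 ?sqr_ge0// andbT.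
apply: contra q0; rewrite paddr_eq0 ?sqr_ge0// !sqrf_eq0 =>
  /andP[/eqP a0 /eqP b0].
by rewrite qE a0 b0 !scale0r addr0.
Qed.

Lemma slice_polar_form J q : slice J q -> q != 0 ->
  exists I th,
    [/\ proj_class I = proj_class J, polar_form q I th & 0 <= th <= pi].
Proof.
move=> qJ q0; have n0 := slice_norm_gt0 qJ q0; have qE := slice_decomp qJ.
set x := cd_re q in n0 qE; set y := cd_dot q _ in n0 qE.
have [r r0 r2] : exists2 r : R, 0 < r & r ^+ 2 = x ^+ 2 + y ^+ 2.
  by exists (Num.sqrt (x ^+ 2 + y ^+ 2)); rewrite ?sqrtr_gt0// sqr_sqrtr// ltW.
have [y0|y0] := leP 0 y.
  have [th thpi [xE yE]] := polar_coord_ge0 r0 r2 y0.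
  exists J, th; split=> //; exists r => //.
  by rewrite scalerDr !scalerA -xE -yE.
have [||th thpi [xE yE]] := @polar_coord_ge0 _ r x (- y) r0.
- by rewrite sqrrN.
- by rewrite oppr_ge0 ltW.
exists (sphere_opp J), th; split=> //; first exact: proj_class_opp.
exists r => //.
by rewrite scalerDr !scalerA -xE -yE scalerN scaleNr opprK.
Qed.

Lemma polar_form_log_manifold q J th : polar_form q J th ->
  log_manifold (q, th *: set_val J).
Proof.
move=> [r r0 qE]; split; last by exists r => //=; rewrite hexp_sphere.
by rewrite /hIm/= -cd_dot1l cd_dotZr cd_dot1l sphere_re mulr0.
Qed.

(** * Local lifts and their concatenation, for data defined on the whole line *)

Section Paths.
Variables (gamma : R -> hc R K) (Igamma : R -> proj_sphere R K).
Hypothesis gamma_continuous : continuous gamma.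
Hypothesis Igamma_continuous : continuous Igamma.
Hypothesis gamma_neq0 : forall t, gamma t != 0.
Hypothesis companion_gamma : forall t, slice_class (Igamma t) (gamma t).

Definition polar_over t J th :=
  proj_class J = Igamma t /\ polar_form (gamma t) J th.

Definition polar_lift c d (J : R -> sphere R K) (ph : R -> R) :=
  [/\ is_path c d J, is_path c d ph &
      forall t, t \in `[c, d] -> polar_over t (J t) (ph t)].

(* With the initial value prescribed, consecutive lifts glue without any further
   adjustment. *)
Definition polar_extends c d := forall J0 th0, polar_over c J0 th0 ->
  exists (J : R -> sphere R K) (ph : R -> R),
    [/\ polar_lift c d J ph, J c = J0 & ph c = th0].

Lemma slice_of_class t J : proj_class J = Igamma t -> slice J (gamma t).
Proof. by move=> JE; rewrite -slice_class_pi JE. Qed.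

(** Composing a section of the projection with the companion gives [J]; composing a local planar
    angle with the coordinates of [gamma] along [1] and [J] gives [ph]. *)
Lemma polar_form_lift t0 : exists (J : R -> sphere R K) (ph : R -> R),
  \forall t \near (t0 : R),
  [/\ {for t, continuous J}, {for t, continuous (ph : R -> R)} &
    polar_over t (J t) (ph t)].
Proof.
pose J0 : sphere R K := repr (Igamma t0 : {eq_quot _}%qT).
have J0E : proj_class J0 = Igamma t0 by exact: reprK.
have [s [sE /= cs]] := proj_section J0; rewrite J0E in cs.
pose J := s \o Igamma.
have JE t : proj_class (J t) = Igamma t by exact: sE.
have cJ : \forall t \near t0, {for t, continuous J}.
  have nI : \forall t \near t0, {for Igamma t, continuous s}.
    exact: Igamma_continuous cs.
  apply: filterS nI => t cst.
  exact: (continuous_comp (@Igamma_continuous t) cst).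
pose z t : R * R := (cd_re (gamma t), cd_dot (gamma t) (set_val (J t))).
have cz t : {for t, continuous J} -> {for t, continuous z}.
  move=> cJt.
  have cvJ := continuous_comp cJt (@set_val_continuous (J t)).
  have cvx : cd_re (gamma u) @[u --> t] --> cd_re (gamma t).
    under eq_fun do rewrite -cd_dot1l.
    by rewrite -cd_dot1l; exact: (cd_dot_cvg (cvg_cst _) (@gamma_continuous t)).
  have cvy : (z u).2 @[u --> t] --> (z t).2.
    exact: (cd_dot_cvg (@gamma_continuous t) cvJ).
  exact: (cvg_pair cvx cvy).
have n0 := slice_norm_gt0 (slice_of_class (JE t0)) (gamma_neq0 t0).
have [A nA] := continuous_polar_angle n0.
exists J, (A \o z).
have nAz : \forall t \near t0, {for z t, continuous A} /\
    exists2 r, 0 < r &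
      (z t).1 = r * cos (A (z t)) /\ (z t).2 = r * sin (A (z t)).
  exact: cz t0 (nbhs_singleton cJ) _ nA.
apply: filterS2 cJ nAz => t cJt [cAt [r r0 [xE yE]]]; split=> //.
  exact: (continuous_comp (cz t cJt) cAt).
split=> //; exists r => //=.
rewrite [LHS](slice_decomp (slice_of_class (JE t))).
by rewrite scalerDr !scalerA -xE -yE.
Qed.

Lemma polar_lift_extends c d (J : R -> sphere R K) ph :
  c <= d -> polar_lift c d J ph -> polar_extends c d.
Proof.
move=> cd liftJ J0 th0 [J0E q0].
have cc : c \in `[c, d] by rewrite in_itv/= lexx.
have shift (I : R -> sphere R K) psi : polar_lift c d I psi -> I c = J0 ->
    exists (J : R -> sphere R K) (ph : R -> R),
      [/\ polar_lift c d J ph, J c = J0 & ph c = th0].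
  move=> [cI cpsi Ipsi] Ic.
  (* Both [psi c] and [th0] are angles of [gamma c] relative to [J0], so the constant shift has
     cosine [1] and sine [0]; the integer number of turns is never extracted. *)
  exists I, (fun t => psi t + (th0 - psi c)); split=> //.
    split=> //.
      by move=> t; exact: (@cvgD _ R^o _ _ _ _ _ _ _ (cpsi t) (cvg_cst _)).
    move=> t /Ipsi[It [r r0 qE]]; split=> //; exists r => //.
    have [_] := Ipsi c cc; rewrite Ic => /polar_form_cos_sin /(_ q0)[cE sE].
    have cD : cos (th0 - psi c) = 1 by rewrite cosB cE sE -!expr2 cos2Dsin2.
    have sD : sin (th0 - psi c) = 0 by rewrite sinB cE sE mulrC subrr.
    by rewrite cosD cD sD sinD cD sD !mulr0 !mulr1 subr0 addr0.
  by rewrite subrKC.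
(* [J c] and [J0] have the same class, so they are equal or opposite; in the second case the shift
   is applied to the lift with both signs reversed. *)
have [_ _ /(_ c cc)[]] := liftJ; rewrite -J0E => /proj_class_eq[Jc|Jc] _.
  exact: shift liftJ Jc.
apply: (shift (@sphere_opp R K \o J) (fun t => - ph t)).
  have [cJ cph Jph] := liftJ; split.
  - move=> t.
    exact: (continuous_comp (cJ t) (@sphere_opp_continuous (J t))).
  - by move=> t; exact: (@cvgN _ R^o _ _ _ _ _ (cph t)).
  - move=> t /Jph[Jt qt]; split; first by rewrite proj_class_opp.
    exact: polar_form_opp.
by rewrite /= Jc sphere_oppK.
Qed.

Lemma polar_extends_trans c d e : c <= d -> d <= e ->
  polar_extends c d -> polar_extends d e -> polar_extends c e.
Proof.
move=> cd de ext1 ext2 J0 th0 /ext1[J1 [ph1 [[cJ1 cph1 lift1] J1c ph1c]]].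
have dcd : d \in `[c, d] by rewrite in_itv/= lexx cd.
(* The final value of the first lift is admissible at [d] and serves as the initial value of the
   second. *)
have [J2 [ph2 [[cJ2 cph2 lift2] J2d ph2d]]] := ext2 _ _ (lift1 d dcd).
have glue (T : topologicalType) (f g : R -> T) : f d = g d ->
    is_path c d f -> is_path d e g ->
    is_path c e (fun t => if t <= d then f t else g t).
  move=> fg cf cg.
  have cdeE : [set` `[c, e]] = `[c, d] `|` `[d, e].
    apply/seteqP; split=> t /=; rewrite !in_itv/=; last first.
      by case=> /andP[? ?]; lra.
    by move=> ?; have [?|?] := leP t d; [left|right]; lra.
  rewrite /is_path cdeE; apply: withinU_continuous.
  - exact: interval_closed.
  - exact: interval_closed.
  - apply: (subspace_eq_continuous _ cf) => t.
    rewrite inE/= in_itv/= => /andP[_ td].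
    by rewrite /from_subspace td.
  - apply: (subspace_eq_continuous _ cg) => t.
    rewrite inE/= in_itv/= => /andP[dt _].
    rewrite /from_subspace; case: leP => // td.
    (* On the second interval the conditional selects [f] only at [d], where [f] and [g] agree. *)
    by have -> : t = d by apply/le_anti/andP.
exists (fun t => if t <= d then J1 t else J2 t).
exists (fun t => if t <= d then ph1 t else ph2 t).
rewrite cd; split=> //; split.
- exact: glue.
- exact: glue.
move=> t; rewrite in_itv/= => /andP[ct te]; case: leP => td.
  by apply: lift1; rewrite in_itv/= ct.
by apply: lift2; rewrite in_itv/= ltW.
Qed.

Lemma polar_extends_segment a b : a <= b -> polar_extends a b.
Proof.
move=> ab; apply: segment_chain => //; first exact: polar_extends_trans.
move=> t0; have [J [ph]] := polar_form_lift t0.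
move=> /nbhs_ballP[e /= e0 He]; exists e => // c d cd ct dt.
(* Balls of the line are convex, so one local lift covers all of [[c, d]]. *)
have cdP t : t \in `[c, d] -> ball t0 e t.
  rewrite in_itv/= => /andP[? ?]; move: ct dt; rewrite /ball/= !ltr_norml; lra.
apply: (@polar_lift_extends _ _ J ph) => //; split.
- by apply: continuous_in_subspaceT => t; rewrite inE/= => /cdP/He[].
- by apply: continuous_in_subspaceT => t; rewrite inE/= => /cdP/He[].
- by move=> t /cdP/He[].
Qed.

End Paths.
End Lifting.

(** * Extension to the whole line, periodicity and assembly of the lifts *)

Lemma is_path_clamp (R : realType) (T : topologicalType) (a b : R)
    (f : R -> T) : a <= b -> is_path a b f ->
  continuous (fun t : R => f (Num.max a (Num.min b t))).
Proof.
move=> ab /subspace_continuousP cf t.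
pose cl (t : R) : R := Num.max a (Num.min b t).
have clab s : `[a, b]%classic (cl s).
  by rewrite /cl/= in_itv/= le_max lexx ge_max ab ge_min lexx.
have ccl : {for t, continuous cl}.
  apply: (@continuous_max R R (cst a) (fun s => Num.min b s)).
    exact: cvg_cst.
  by apply: (@continuous_min R R (cst b) id); [exact: cvg_cst|exact: cvg_id].
(* Continuity of [f] is only relative to the segment, which suffices because [cl] takes all its
   values there. *)
apply: (cvg_trans _ (cf _ (clab t))) => W /= Wf.
have nW : \forall s \near t, `[a, b]%classic (cl s) -> W (f (cl s)) := ccl _ Wf.
by apply: filterS nW => s; exact.
Qed.

Lemma cos_sinD2kpi (R : realType) (x : R) (k : int) :
  cos (x + 2 * k%:~R * pi) = cos x /\ sin (x + 2 * k%:~R * pi) = sin x.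
Proof.
have nat_case (n : nat) (y : R) :
    cos (y + 2 * n%:R * pi) = cos y /\ sin (y + 2 * n%:R * pi) = sin y.
  have -> : 2 * n%:R * pi = (pi *+ 2) *+ n :> R.
    by rewrite -[RHS]mulr_natl -[pi *+ 2]mulr_natl; ring.
  by rewrite (periodicn (@cosD2pi R)) (periodicn (@sinD2pi R)).
case: k => n; first exact: nat_case.
(* [Negz n] is minus [n.+1], so adding [n.+1] periods returns to [x]. *)
have [<- <-] := nat_case n.+1 (x + 2 * (Negz n)%:~R * pi).
have -> : x + 2 * (Negz n)%:~R * pi + 2 * n.+1%:R * pi = x.
  by rewrite NegzE mulrNz; ring.
by [].
Qed.

Theorem proposition4p12 (R : realType) (K : hypercomplex) (a b : R)
    (gamma : R -> hc R K) (Igamma : R -> proj_sphere R K)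
    (le_ab : a <= b)
    (path_gamma : is_path a b gamma)
    (gamma_neq0 : forall t, t \in `[a, b] -> gamma t != 0)
    (companion_gamma : is_companion a b gamma Igamma) :
  exists (I : R -> sphere R K) (arg : R -> R),
    let Arg (t : R) : hc R K := arg t *: set_val (I t) in
    let Gamma (t : R) : hc R K * hc R K := (gamma t, Arg t) in
    let arg2 (k : int) (t : R) : R := arg t + 2 * k%:~R * pi in
    let Arg2 (k : int) (t : R) : hc R K := arg2 k t *: set_val (I t) in
    let Gammak (k : int) (t : R) : hc R K * hc R K := (gamma t, Arg2 k t) in
    [/\ is_path a b I /\
          (forall t, t \in `[a, b] -> proj_class (I t) = Igamma t),
        is_path a b arg,
        is_lift a b gamma Gamma /\ 0 <= arg a <= pi &
        forall k : int,
          is_lift a b gamma (Gammak k) /\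
          2 * k%:~R * pi <= arg2 k a <= (2 * k%:~R + 1) * pi].
Proof.
have [path_I slice_I] := companion_gamma.
(* Retracting the line onto [[a, b]] extends [gamma] and its companion by constants, so continuity,
   nonvanishing and the slice condition hold at every real [t]. *)
pose cl (t : R) : R := Num.max a (Num.min b t).
have clab t : cl t \in `[a, b].
  by rewrite /cl in_itv/= le_max lexx ge_max le_ab ge_min lexx.
have clE t : t \in `[a, b] -> cl t = t.
  by rewrite in_itv/= /cl => /andP[ta tb]; rewrite (min_r tb) (max_r ta).
pose g t := gamma (cl t); pose C t := Igamma (cl t).
have cg : continuous g by exact: is_path_clamp.
have cC : continuous C by exact: is_path_clamp.
have g0 t : g t != 0 by exact: gamma_neq0.
have gC t : slice_class (C t) (g t) by exact: slice_I.
have aab : a \in `[a, b] by rewrite in_itv/= lexx.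
have [J0 J0E] : exists J, proj_class J = C a.
  by exists (repr (C a : {eq_quot _}%qT)); exact: reprK.
have [I0 [th0 [I0E polar0 th0pi]]] :=
  slice_polar_form (slice_of_class gC J0E) (g0 a).
have [|I [arg [[path_Il path_arg over_g] Ia arga]]] :=
  @polar_extends_segment R K g C cg cC g0 gC a b le_ab I0 th0.
  by split; first rewrite I0E.
(* One argument serves every [k]; the unshifted lift is recovered at [k = 0]. *)
have lift k : is_lift a b gamma
    (fun t => (gamma t, (arg t + 2 * k%:~R * pi) *: (set_val (I t) : hc R K))).
  split=> //.
    pose arg2 (t : R) : R := arg t + 2 * k%:~R * pi.
    have path_arg2 : is_path a b arg2.
      move=> t; exact: (@cvgD _ R^o _ _ _ _ _ _ _ (path_arg t) (cvg_cst _)).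
    have path_Arg2 : is_path a b (fun t => arg2 t *: (set_val (I t) : hc R K)).
      move=> t.
      have cI := continuous_comp (path_Il t) (@set_val_continuous R K (I t)).
      exact: (cvgZ (path_arg2 t) cI).
    move=> t; exact: (cvg_pair (path_gamma t) (path_Arg2 t)).
  move=> t tab; apply: polar_form_log_manifold.
  have [_ [r r0]] := over_g t tab; rewrite /g clE// => qE.
  by exists r => //; have [-> ->] := cos_sinD2kpi (arg t) k.
exists I, arg => Arg Gamma arg2 Arg2 Gammak; split=> //.
- by split=> // t tab; have [->] := over_g t tab; rewrite /C clE.
- split; last by rewrite arga.
  have -> : Gamma = fun t =>
      (gamma t, (arg t + 2 * (0 : int)%:~R * pi) *: (set_val (I t) : hc R K)).
    by apply/funext => t; rewrite /Gamma /Arg mulr0 mul0r addr0.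
  exact: lift.
- move=> k; split; first exact: lift.
  by rewrite /arg2 arga; case/andP: th0pi => ? ?; apply/andP; split; lra.
Qed.
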